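(* Let $\mathfrak C$ be a left cancellative small category. Then $I_l\,\bar\ltimes\,\partial\Omega$ is Hausdorff if and only if for all $s\in I_l$ there exist $\varepsilon_1,\dots,\varepsilon_n\in\bar{\mathcal J}$ with $s\varepsilon_i=\varepsilon_i$ such that for all $\emptyset\ne e\in\mathcal J$ with $se=e$ there exists $1\le i\le n$ such that $e\varepsilon_i\ne\emptyset$.
   Context: $\mathfrak C$ denotes the set of morphisms, $\mathfrak C^0\subseteq\mathfrak C$ the identity morphisms, $\mathfrak d,\mathfrak t$ domain and target; $cd$ is defined iff $\mathfrak d(c)=\mathfrak t(d)$; left cancellative means $cx=cy\Rightarrow x=y$. Each $c\in\mathfrak C$ gives the partial bijection $\mathfrak d(c)\mathfrak C\to c\mathfrak C$, $x\mapsto cx$; $I_l$ is the smallest semigroup of partial bijections of $\mathfrak C$ containing these and closed under inverses; $\mathcal J=\{\mathrm{dom}(s):s\in I_l\}$ is its semilattice of idempotents (product = intersection). $\bar{\mathcal J}$ is the set of subsets $\varepsilon=e\setminus\bigcup_{i=1}^nf_i$ of $\mathfrak C$ with $e,f_1,\dots,f_n\in\mathcal J$, $f_i\subseteq e$. For $s\in I_l$ and a set $\varepsilon\in\bar{\mathcal J}$, $s\varepsilon$ is the restriction of $s$ to $\varepsilon\cap\mathrm{dom}(s)$; $s\varepsilon=\varepsilon$ means $\varepsilon\subseteq\mathrm{dom}(s)$ and $s(x)=x$ for all $x\in\varepsilon$; $e\varepsilon=e\cap\varepsilon$. The list $\varepsilon_1,\dots,\varepsilon_n$ may be empty. $\widehat{\mathcal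 J}$ is the space of non-zero multiplicative maps $\chi:\mathcal J\to\{0,1\}$ with $\chi(\emptyset)=0$ if $\emptyset\in\mathcal J$ (pointwise convergence). $\Omega\subseteq\widehat{\mathcal J}$ consists of those $\chi$ such that whenever $e=\bigcup_{i=1}^nf_i$ ($e,f_i\in\mathcal J$) and $\chi(e)=1$, then $\chi(f_i)=1$ for some $i$. For $\chi\in\Omega$, $\varepsilon=e\setminus\bigcup f_i\in\bar{\mathcal J}$, put $\chi(\varepsilon)=1$ iff $\chi(e)=1$ and all $\chi(f_i)=0$, and $\chi(\varepsilon)=0$ otherwise. $\partial\Omega\subseteq\Omega$ is the closure of the set of $\chi\in\widehat{\mathcal J}$ with $\chi^{-1}(1)$ maximal. $s\in I_l$ acts by $\chi\mapsto s.\chi=\chi(s^{-1}\cdot s)$ from $\{\chi\in\partial\Omega:\chi(s^{-1}s)=1\}$ onto $\{\chi\in\partial\Omega:\chi(ss^{-1})=1\}$. $I_l\,\bar\ltimes\,\partial\Omega$ is the groupoid of classes $[s,\chi]^{\bar\sim}$, $s\in I_l$, $\chi\in\partial\Omega$, $\chi(s^{-1}s)=1$, where $(s,\chi)\bar\sim(t,\psi)$ iff $\chi=\psi$ and $s\varepsilon=t\varepsilon$ for some $\varepsilon\in\bar{\mathcal J}$ with $\chi(\varepsilon)=1$; source $\chi$, range $s.\chi$; topology such that the sets $\{[s,\chi]^{\bar\sim}:\chi(s^{-1}s)=1\}$ are open and mapped homeomorphically by the source map onto $\{\chi\in\partial\Omega:\chi(s^{-1}s)=1\}$. *)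

(* Defs.v *)
From HB Require Import structures.
From mathcomp Require Import all_boot all_order all_algebra.
From mathcomp Require Import all_classical.
From mathcomp Require Import topology_structure supremum_topology.
From mathcomp Require Import initial_topology subtype_topology.
From mathcomp Require Import discrete_topology bool_topology.
From mathcomp Require Import function_spaces sigT_topology.
From mathcomp Require Import quotient_topology separation_axioms.

Set Implicit Arguments.
Unset Strict Implicit.
Unset Printing Implicit Defensive.

Local Open Scope classical_set_scope.
Local Open Scope quotient_scope.

(* A small category given by its set of morphisms; objects are identified with
   their identity morphisms, so [mdom] and [mtgt] take values in morphisms.
   [mcomp c d] is only meaningful when [mdom c = mtgt d]; its other values are
   never used. *)
Record category := Category {
  mor :> Type;
  mdom : mor -> mor;
  mtgt : mor -> mor;
  mcomp : mor -> mor -> mor;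
  dom_dom : forall c, mdom (mdom c) = mdom c;
  tgt_dom : forall c, mtgt (mdom c) = mdom c;
  dom_tgt : forall c, mdom (mtgt c) = mtgt c;
  tgt_tgt : forall c, mtgt (mtgt c) = mtgt c;
  dom_comp : forall c d, mdom c = mtgt d -> mdom (mcomp c d) = mdom d;
  tgt_comp : forall c d, mdom c = mtgt d -> mtgt (mcomp c d) = mtgt c;
  comp_dom : forall c, mcomp c (mdom c) = c;
  comp_tgt : forall c, mcomp (mtgt c) c = c;
  comp_assoc : forall c d x, mdom c = mtgt d -> mdom d = mtgt x ->
    mcomp (mcomp c d) x = mcomp c (mcomp d x) }.

Definition left_cancellative (C : category) : Prop :=
  forall c x y : C, mdom c = mtgt x -> mdom c = mtgt y ->
    mcomp c x = mcomp c y -> x = y.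

Record lc_category := LCCategory {
  lc_cat :> category;
  lc_cancel : left_cancellative lc_cat }.

Section PartialBijections.
Context {T : Type}.

(* Partial maps are represented by their graphs. *)
Definition partial_bijection (s : set (T * T)) : Prop :=
  (forall x y y', s (x, y) -> s (x, y') -> y = y') /\
  (forall x x' y, s (x, y) -> s (x', y) -> x = x').

(* first [t], then [s] *)
Definition pcomp (s t : set (T * T)) : set (T * T) :=
  [set p | exists y, t (p.1, y) /\ s (y, p.2)].

Definition pinv (s : set (T * T)) : set (T * T) := [set p | s (p.2, p.1)].

Definition prestr (s : set (T * T)) (E : set T) : set (T * T) :=
  [set p | s p /\ E p.1].

Definition pid (E : set T) : set (T * T) := [set p | E p.1 /\ p.2 = p.1].

End PartialBijections.

Section LeftInverseHull.
Context {C : lc_category}.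

(* [x |-> c x] on [d(c) C = {x | t(x) = d(c)}] *)
Definition lmul (c : C) : set (C * C) :=
  [set p | mdom c = mtgt p.1 /\ p.2 = mcomp c p.1].

Inductive Il : set (set (C * C)) :=
| Il_lmul c : Il (lmul c)
| Il_comp s t : Il s -> Il t -> Il (pcomp s t)
| Il_inv s : Il s -> Il (pinv s).

Lemma Il_pbij s : Il s -> partial_bijection s.
Proof.
elim=> [c|{}s t _ [sf si] _ [tf ti]|{}s _ [sf si]].
- split=> [x y y' [/= _ ->] [/= _ ->]//|x x' y [/= h ->] [/= h' e]].
  exact: (lc_cancel h h').
- split=> [x y y' [z [/= h1 h2]] [z' [/= h3 h4]]|].
    by move: h4; rewrite -(tf _ _ _ h1 h3); exact: sf.
  move=> x x' y [z [/= h1 h2]] [z' [/= h3 h4]].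
  by move: h3; rewrite -(si _ _ _ h2 h4); exact: ti.
- by split=> [x y y'|x x' y] /=; [exact: si|exact: sf].
Qed.

(* [A.`1] is the domain of the partial map with graph [A]. *)
Definition J : set (set C) := [set s.`1 | s in Il].

Lemma J_dom (s : Il) : J (val s).`1.
Proof. by exists (val s) => //; exact: set_valP. Qed.

Definition Jdom (s : Il) : J := SigSub (mem_set (J_dom s)).

(* [{x in dom(s) | s(x) in e} = dom(t \o s)] when [e = dom(t)] *)
Lemma J_preim (s : Il) (e : J) :
  J [set x | exists2 y, val s (x, y) & val e y].
Proof.
have [t It te] := set_valP e; exists (pcomp t (val s)).
  by apply: Il_comp => //; exact: set_valP.
rewrite -te predeqE => x; split=> [[z [y [/= sxy tyz]]]|[y sxy [z tyz]]].
  by exists y => //; exists z.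
by exists z, y.
Qed.

(* the idempotent [s^-1 e s] *)
Definition Jpreim (s : Il) (e : J) : J := SigSub (mem_set (J_preim s e)).

Lemma J_setI (e f : J) : J (val e `&` val f).
Proof.
have [t It te] := set_valP f.
have Iid : Il (pcomp (pinv t) t) by apply: Il_comp => //; exact: Il_inv.
have := J_preim (SigSub (mem_set Iid)) e; congr (J _).
rewrite -te predeqE => x; split=> /= [[z [y [/= txy tzy]] ez]|[ex [y txy]]].
  by rewrite ((Il_pbij It).2 _ _ _ txy tzy); split=> //; exists y.
by exists x => //; exists y.
Qed.

Definition Jmeet (e f : J) : J := SigSub (mem_set (J_setI e f)).

Definition Jbar_rep (E : set C) (e : J) (n : nat) (f : 'I_n -> J) : Prop :=
  (forall i, val (f i) `<=` val e) /\
  E = val e `\` \bigcup_i val (f i).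

Definition Jbar : set (set C) :=
  [set E | exists (e : J) (n : nat) (f : 'I_n -> J), Jbar_rep E e f].

End LeftInverseHull.
Arguments Il C : clear implicits.
Arguments J C : clear implicits.
Arguments Jbar C : clear implicits.

Section Characters.
Context {C : lc_category}.

Definition Jhat : set {ptws J C -> bool} :=
  [set chi : {ptws J C -> bool} | [/\ exists e, chi e,
                 forall e f, chi (Jmeet e f) = chi e && chi f &
                 forall e, val e = set0 -> chi e = false]].

Definition Omega : set Jhat :=
  [set chi : Jhat | forall (e : J C) (n : nat) (f : 'I_n -> J C),
     val e = \bigcup_i val (f i) -> val chi e -> exists i, val chi (f i)].

Definition Jmax : set Jhat :=
  [set chi : Jhat | forall psi : Jhat,
     [set e | val chi e] `<=` [set e | val psi e] ->
     [set e | val chi e] = [set e | val psi e]].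

Definition dOmega : set Jhat := closure Jmax.

(* [chi(E) = 1]; independent of the representation of [E] when [chi] lies in
   [Omega], see [on_Jbar_rep]. *)
Definition on_Jbar (chi : Jhat) (E : set C) : Prop :=
  exists (e : J C) (n : nat) (f : 'I_n -> J C),
    [/\ Jbar_rep E e f, val chi e & forall i, val chi (f i) = false].

Lemma Jval_inj (e f : J C) : val e = val f -> e = f.
Proof. exact: val_inj. Qed.

Lemma JhatM (chi : Jhat) e f : val chi (Jmeet e f) = val chi e && val chi f.
Proof. by have [_ + _] := set_valP chi; exact. Qed.

Lemma Jhat0 (chi : Jhat) e : val e = set0 -> val chi e = false.
Proof. by have [_ _] := set_valP chi; exact. Qed.

Lemma Jhat_le (chi : Jhat) (e f : J C) :
  val e `<=` val f -> val chi e -> val chi f.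
Proof.
move=> ef; have <- : Jmeet e f = e by apply: Jval_inj; exact/setIidPl.
by rewrite JhatM => /andP[].
Qed.

Lemma on_Jbar_le (chi : Jhat) E (e : J C) :
  Omega chi -> on_Jbar chi E -> E `<=` val e -> val chi e.
Proof.
move=> Ochi [e' [n' [f' [[fe' ->] ce' cf']]]] le.
pose g (i : 'I_n'.+1) := if unlift ord0 i is Some j then f' j else Jmeet e e'.
have : val e' = \bigcup_i val (g i).
  rewrite predeqE => x; split=> [e'x|[i _]].
    have [[j _ fx]|nfx] := pselect ((\bigcup_i val (f' i)) x).
      by exists (lift ord0 j) => //; rewrite /g liftK.
    exists ord0 => //; rewrite /g unlift_none /=; split=> //.
    exact: le.
  by rewrite /g; case: unliftP => [j _ /fe'|_ []].
move/Ochi => /(_ ce')[i]; rewrite /g; case: unliftP => [j _|_].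
  by rewrite cf'.
by rewrite JhatM => /andP[].
Qed.

Lemma on_Jbar_rep (chi : Jhat) E e n (f : 'I_n -> J C) :
  Omega chi -> Jbar_rep E e f ->
  on_Jbar chi E <-> val chi e /\ forall i, val chi (f i) = false.
Proof.
move=> Ochi [fe Ee]; split=> [cE|[ce cf]]; last by exists e, n, f.
have ce : val chi e by apply: (on_Jbar_le Ochi cE); rewrite Ee => x [].
split=> //; move: cE => [e' [n' [f' [[fe' Ee'] ce' cf']]]].
have Eeq x : (val e `\` \bigcup_i val (f i)) x <->
             (val e' `\` \bigcup_i val (f' i)) x by rewrite -Ee -Ee'.
move=> i; apply/negbTE/negP => cfi.
have : val (Jmeet (f i) e') = \bigcup_j val (Jmeet (Jmeet (f i) e') (f' j)).
  rewrite predeqE => x; split=> [[fx ex]|[j _ []//]].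
  have [[j _ f'x]|nfx] := pselect ((\bigcup_i val (f' i)) x).
    by exists j.
  have /Eeq[_ []] : (val e' `\` \bigcup_i val (f' i)) x by [].
  by exists i.
move/Ochi; rewrite JhatM cfi ce' => /(_ isT)[j].
by rewrite JhatM cf' andbF.
Qed.

Lemma ptws_eval_continuous (e : J C) :
  continuous (fun g : {ptws J C -> bool} => g e).
Proof. exact: (@proj_continuous (J C) (fun=> bool) e). Qed.

Lemma Jhat_eval_continuous (e : J C) :
  continuous (fun chi : Jhat => val chi e).
Proof.
move=> chi; apply: (@continuous_comp Jhat {ptws J C -> bool} bool val
                      (fun g => g e)); last exact: ptws_eval_continuous.
exact: initial_continuous.
Qed.

Lemma Jhat_eval_nbhs (chi : Jhat) (e : J C) :
  nbhs chi [set psi : Jhat | val psi e = val chi e].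
Proof.
have /(_ [set val chi e]) := @Jhat_eval_continuous e chi; apply.
exact: discrete_set1.
Qed.

Lemma Jmax_meet0 (chi : Jhat) (f : J C) : Jmax chi -> val chi f = false ->
  exists2 e, val chi e & val e `&` val f = set0.
Proof.
move=> mchi cf; apply: contrapT => nex.
pose psi : {ptws J C -> bool} :=
  fun g => `[< exists2 e, val chi e & val e `&` val f `<=` val g >].
have psiP : Jhat psi.
  split.
  - have [[e ce] _ _] := set_valP chi.
    by exists e; apply/asboolP; exists e => //; exact: subIsetl.
  - move=> g h; apply/idP/andP => [/asboolP[e ce /= eg]|].
      split; apply/asboolP; exists e => //.
        by move=> x /eg[].
      by move=> x /eg[].
    move=> [/asboolP[e ce eg] /asboolP[e' ce' eh]].
    apply/asboolP; exists (Jmeet e e'); first by rewrite JhatM ce ce'.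
    by move=> x /= [[ex e'x] fx]; split; [exact: eg|exact: eh].
  - move=> g g0; apply/asboolP => -[e ce]; rewrite g0 subset0 => ef0.
    by apply: nex; exists e.
have := mchi (SigSub (mem_set psiP)).
have le : [set e | val chi e] `<=` [set e | psi e].
  by move=> e /= ce; apply/asboolP; exists e => //; exact: subIsetl.
move/(_ le) => eqs.
have [[e0 ce0] _ _] := set_valP chi.
have : [set e | psi e] f.
  by apply/asboolP; exists e0 => //; exact: subIsetr.
by rewrite -[X in X f]eqs /= cf.
Qed.

Lemma Jmax_Omega : Jmax `<=` Omega.
Proof.
move=> chi mchi e n f ef ce; apply: contrapT => /forallNP nf.
have cf i : val chi (f i) = false by apply/negbTE/negP; exact: nf.
have [g cg g0] : exists2 g, val chi g &
    forall i : 'I_n, val g `&` val (f i) = set0.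
  have H k : (k <= n)%N -> exists2 g, val chi g &
      forall i : 'I_n, (i < k)%N -> val g `&` val (f i) = set0.
    elim: k => [_|k IH kn]; first by exists e.
    have [g cg gf] := IH (ltnW kn).
    have [h ch hf] := Jmax_meet0 mchi (cf (Ordinal kn)).
    exists (Jmeet g h) => [|i]; first by rewrite JhatM cg ch.
    rewrite ltnS leq_eqVlt => /orP[/eqP ik|ik].
      rewrite -subset0 => x [[/= _ hx]].
      have -> : i = Ordinal kn by exact: val_inj.
      by move=> fx; have : (val h `&` val (f (Ordinal kn))) x by []; rewrite hf.
    by rewrite -subset0 => x [[gx _] fx]; rewrite -(gf i ik).
  have [g cg gf] := H n (leqnn n).
  by exists g => // i; exact: gf.
have : val chi (Jmeet g e) by rewrite JhatM cg ce.
rewrite Jhat0 // -subset0 => x [/= gx]; rewrite ef => -[i _ fx].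
by have : (val g `&` val (f i)) x by []; rewrite g0.
Qed.

Lemma dOmega_Omega : dOmega `<=` Omega.
Proof.
move=> chi cl e n f ef ce.
have nb : nbhs chi [set psi : Jhat | val psi e = val chi e /\
    forall i, val psi (f i) = val chi (f i)].
  apply: filterI; first exact: Jhat_eval_nbhs.
  have := @filter_forall _ 'I_n
    (fun i (psi : Jhat) => val psi (f i) = val chi (f i)) _ (nbhs_filter chi).
  by apply => i; exact: Jhat_eval_nbhs.
have [psi [mpsi [pe pf]]] := cl _ nb.
have [|i] := Jmax_Omega mpsi ef; first by rewrite pe.
by rewrite pf; exists i.
Qed.

End Characters.

Section Action.
Context {C : lc_category}.
Implicit Types (s t : Il C) (e f : J C).

Definition Iinv s : Il C := SigSub (mem_set (Il_inv (set_valP s))).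

(* [chi(s^-1 . s)] *)
Definition act_fun s (chi : {ptws J C -> bool}) : {ptws J C -> bool} :=
  fun e => chi (Jpreim s e).

Lemma IinvK s : Iinv (Iinv s) = s.
Proof. by apply: val_inj; rewrite predeqE => -[x y]. Qed.

Lemma Jpreim_ran s : Jpreim s (Jdom (Iinv s)) = Jdom s.
Proof.
apply: Jval_inj; rewrite predeqE => x; split=> /= [[y sxy _]|[y sxy]].
  by exists y.
by exists y => //; exists x.
Qed.

Lemma act_funP s (chi : @Jhat C) :
  val chi (Jdom s) -> Jhat (act_fun s (val chi)).
Proof.
move=> cs; have [_ cM c0] := set_valP chi.
have [sf si] := Il_pbij (set_valP s); split.
- by exists (Jdom (Iinv s)); rewrite /act_fun Jpreim_ran.
- move=> e f; rewrite /act_fun -cM; congr (val chi _).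
  apply: Jval_inj; rewrite predeqE => x; split=> /= [[y sxy [ey fy]]|].
    by split; exists y.
  move=> [[y sxy ey] [y' sxy' fy]]; exists y => //; split=> //.
  by rewrite (sf _ _ _ sxy sxy').
- move=> e e0; apply: c0; rewrite -subset0 => x /= [y _].
  by rewrite e0.
Qed.

Definition act_Jhat s (chi : @Jhat C) (h : val chi (Jdom s)) : @Jhat C :=
  SigSub (mem_set (act_funP h)).

Lemma act_funK s (chi : @Jhat C) : val chi (Jdom s) ->
  act_fun (Iinv s) (act_fun s (val chi)) = val chi.
Proof.
move=> cs; apply: funext => e; rewrite /act_fun.
suff -> : Jpreim s (Jpreim (Iinv s) e) = Jmeet (Jdom s) e by rewrite JhatM cs.
have [_ si] := Il_pbij (set_valP s).
apply: Jval_inj; rewrite predeqE => x; split=> /= [[y sxy [z szy ez]]|].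
  by rewrite (si _ _ _ sxy szy); split=> //; exists y.
by move=> [[y sxy] ex]; exists y => //; exists x.
Qed.

Lemma act_Jmax s (chi : @Jhat C) (h : val chi (Jdom s)) :
  Jmax chi -> Jmax (act_Jhat h).
Proof.
move=> mchi psi le.
have ps : val psi (Jdom (Iinv s)).
  by apply: le; rewrite /= /act_fun Jpreim_ran.
have eqs := mchi (act_Jhat ps).
have {}eqs : [set e | val chi e] = [set e | val (act_Jhat ps) e].
  apply: eqs => e /=; rewrite -{1}(act_funK h) /act_fun => ce.
  by apply: (le (Jpreim (Iinv s) e)).
have {}eqs : val chi = act_fun (Iinv s) (val psi).
  apply: funext => e; apply/idP/idP => ce.
    by have : [set e | val chi e] e by []; rewrite eqs.
  by have : [set e | val (act_Jhat ps) e] e by []; rewrite -eqs.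
have -> : val psi = act_fun s (val chi).
  by rewrite eqs -{1}(IinvK s) act_funK.
by [].
Qed.

Lemma act_fun_continuous s : continuous (act_fun s).
Proof.
move=> chi; apply/cvg_sup => e A /= [_ [[B oB <-] /= Bfs sBA]].
apply: (filterS sBA).
apply: (@ptws_eval_continuous C (Jpreim s e) chi B).
exact: open_nbhs_nbhs.
Qed.

Lemma act_dOmega s (chi : @Jhat C) (h : val chi (Jdom s)) :
  dOmega chi -> dOmega (act_Jhat h).
Proof.
move=> cl U [_ [[W oW <-] /= Wc sWU]].
have nb : nbhs chi [set psi : @Jhat C | W (act_fun s (val psi)) /\
    val psi (Jdom s) = val chi (Jdom s)].
  apply: filterI; last exact: Jhat_eval_nbhs.
  apply: (@continuous_comp (@Jhat C) {ptws J C -> bool} {ptws J C -> bool}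
           val (act_fun s)).
  - exact: initial_continuous.
  - exact: act_fun_continuous.
  - exact: open_nbhs_nbhs.
have [psi [mpsi [Wpsi pe]]] := cl _ nb.
have ps : val psi (Jdom s) by rewrite pe.
exists (act_Jhat ps); split; first exact: act_Jmax.
by apply: sWU.
Qed.

(* [{chi in dOmega | chi(s^-1 s) = 1}] *)
Definition act_dom s : set (@dOmega C) :=
  [set chi : dOmega | val (val chi) (Jdom s)].

(* [s.chi] *)
Definition act s (chi : act_dom s) : @dOmega C :=
  SigSub (mem_set (@act_dOmega s _ (set_valP chi) (set_valP (val chi)))).

Lemma act_onto s (psi : @dOmega C) : act_dom (Iinv s) psi ->
  exists chi : act_dom s, act chi = psi.
Proof.
move=> h; have ho : act_dom s (act (SigSub (mem_set h))).
  rewrite /act_dom/= /act_fun -{2}(IinvK s) Jpreim_ran.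
  exact: h.
exists (SigSub (mem_set ho)); apply: val_inj; apply: val_inj => /=.
by rewrite -{1}(IinvK s) act_funK.
Qed.

Lemma act_ran s (chi : act_dom s) : act_dom (Iinv s) (act chi).
Proof. by rewrite /act_dom /= /act_fun Jpreim_ran; exact: set_valP chi. Qed.

End Action.

Section Germs.
Context {C : lc_category}.

(* pairs [(s, chi)] with [chi] in [dOmega] and [chi(s^-1 s) = 1], with the
   disjoint union topology ([Il] being discrete) *)
Definition pregerm : Type := {s : Il C & act_dom s}.
HB.instance Definition _ := Topological.copy pregerm {s : Il C & act_dom s}.

Definition pregerm_char (x : pregerm) : @dOmega C := val (projT2 x).

Definition germ_eq (x y : pregerm) : Prop :=
  pregerm_char x = pregerm_char y /\
  exists E, [/\ Jbar C E, on_Jbar (val (pregerm_char x)) E &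
    prestr (val (projT1 x)) E = prestr (val (projT1 y)) E].

Definition germ_eqb : rel pregerm := fun x y => `[< germ_eq x y >].

Lemma on_JbarT (chi : @Jhat C) (e : J C) : val chi e -> on_Jbar chi (val e).
Proof.
move=> ce; exists e, 0%N, (fun=> e); split=> //; last by case.
split=> [[]//|]; rewrite (_ : \bigcup_i _ = set0) ?setD0//.
by rewrite -subset0 => x [[]].
Qed.

Lemma on_Jbar_sub (chi : @Jhat C) E : on_Jbar chi E -> Jbar C E.
Proof. by move=> [e [n [f [r _ _]]]]; exists e, n, f. Qed.

Lemma on_JbarI (chi : @Jhat C) E F :
  on_Jbar chi E -> on_Jbar chi F -> on_Jbar chi (E `&` F).
Proof.
move=> [e [n [f [[fe ->] ce cf]]]] [e' [m [g [[ge ->] ce' cg]]]].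
pose h (i : 'I_(n + m)) := match fintype.split i with
  | inl j => Jmeet (f j) e' | inr j => Jmeet e (g j) end.
exists (Jmeet e e'), (n + m)%N, h; split; first split.
- by move=> i x; rewrite /h; case: fintype.split => j [/= h1 h2]; split=> //;
    [exact: fe h1|exact: ge h2].
- rewrite predeqE => x; split=> [[[ex nf] [e'x ng]]|[[/= ex e'x] nh]].
    split=> // -[i _]; rewrite /h; case: fintype.split => j [/= h1 h2].
      by apply: nf; exists j.
    by apply: ng; exists j.
  split; split=> // -[j _ hj]; apply: nh.
    by exists (lshift m j) => //; rewrite /h
       (unsplitK (inl j) : fintype.split (lshift m j) = inl j).
  by exists (rshift n j) => //; rewrite /h
     (unsplitK (inr j) : fintype.split (rshift n j) = inr j).
- by rewrite JhatM ce ce'.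
- by move=> i; rewrite /h; case: fintype.split => j; rewrite JhatM ?cf ?cg ?andbF.
Qed.

Lemma prestrI (s t : set (C * C)) E F :
  prestr s E = prestr t E -> prestr s (E `&` F) = prestr t (E `&` F).
Proof.
move=> h; rewrite predeqE => p; split=> -[sp [Ep Fp]].
  by have : prestr s E p by []; rewrite h => -[].
by have : prestr t E p by []; rewrite -h => -[].
Qed.

Lemma germ_eqb_refl : reflexive germ_eqb.
Proof.
move=> x; apply/asboolP; split=> //.
exists (val (Jdom (projT1 x))); have := on_JbarT (set_valP (projT2 x)).
by move=> h; split=> //; exact: on_Jbar_sub h.
Qed.

Lemma germ_eqb_sym : symmetric germ_eqb.
Proof.
suff h x y : germ_eq x y -> germ_eq y x.
  by move=> x y; apply/asboolP/asboolP; exact: h.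
by move=> [e [E [JE cE xy]]]; split=> //; exists E; rewrite -e.
Qed.

Lemma germ_eqb_trans : transitive germ_eqb.
Proof.
move=> y x z /asboolP[e [E [JE cE xy]]] /asboolP[e' [F [JF cF yz]]].
apply/asboolP; split; first by rewrite e.
rewrite -e in cF; exists (E `&` F); have cEF := on_JbarI cE cF; split=> //.
  exact: on_Jbar_sub cEF.
by rewrite (prestrI _ xy) setIC (prestrI _ yz).
Qed.

Canonical germ_equiv := EquivRel germ_eqb
  germ_eqb_refl germ_eqb_sym germ_eqb_trans.

Lemma germ_eq_act (x y : pregerm) :
  germ_eq x y -> act (projT2 x) = act (projT2 y).
Proof.
have H (u v : pregerm) (e : J C) : germ_eq u v ->
    val (val (act (projT2 u))) e -> val (val (act (projT2 v))) e.
  move=> [echi [E [JE cE uv]]] ce.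
  have cG := on_JbarI cE
    (@on_JbarT (val (pregerm_char u)) (Jpreim (projT1 u) e) ce).
  suff : val (val (pregerm_char v)) (Jpreim (projT1 v) e) by [].
  rewrite -echi; apply: (on_Jbar_le _ cG).
    exact/dOmega_Omega/(set_valP (pregerm_char u)).
  move=> z [Ez /= [w szw ew]]; exists w => //.
  have : prestr (val (projT1 u)) E (z, w) by [].
  by rewrite uv => -[].
move=> xy; apply: val_inj; apply: val_inj; apply: funext => e.
apply/idP/idP; first exact: H.
by apply: H; apply/asboolP; rewrite -/(germ_eqb y x) germ_eqb_sym;
  apply/asboolP.
Qed.

End Germs.
Arguments pregerm C : clear implicits.
Arguments germ_equiv C : clear implicits.

(* The space of arrows.  Since each [{[s, chi] | chi(s^-1 s) = 1}] is open and
   homeomorphic to [act_dom s] through the source map, the topology is the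
   final one for the maps [chi |-> [s, chi]], that is, the quotient of the
   disjoint union; [open_bisection], [germ_continuous], [germ_source_continuous]
   and [germ_sourceE] show that it has the required property.  The composition
   [[s, t.chi][t, chi] = [st, chi]] does not enter into being Hausdorff and is
   not defined. *)
Definition groupoid (C : lc_category) : Type :=
  quotient_topology {eq_quot (germ_equiv C)}.
HB.instance Definition _ (C : lc_category) := Topological.copy (groupoid C)
  (quotient_topology {eq_quot (germ_equiv C)}).
HB.instance Definition _ (C : lc_category) := Quotient.copy (groupoid C)
  (quotient_topology {eq_quot (germ_equiv C)}).

Section GroupoidTopology.
Context {C : lc_category}.

(* [[s, chi]] *)
Definition germ (s : Il C) (chi : act_dom s) : groupoid C :=
  \pi_(groupoid C) (existT (fun s : Il C => act_dom s) s chi : pregerm C).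

Definition germ_source (g : groupoid C) : @dOmega C := pregerm_char (repr g).

Definition germ_range (g : groupoid C) : @dOmega C := act (projT2 (repr g)).

Definition bisection (s : Il C) : set (groupoid C) :=
  [set g | exists chi : act_dom s, g = germ chi].

Lemma germP (s t : Il C) (chi : act_dom s) (psi : act_dom t) :
  germ chi = germ psi <->
  germ_eq (existT (fun s : Il C => act_dom s) s chi)
          (existT (fun s : Il C => act_dom s) t psi).
Proof.
split=> [/eqP|h].
  rewrite /germ => /eqP/(@eqquotP _ _ {eq_quot (germ_equiv C)}) h.
  exact/asboolP.
by apply/(@eqquotP _ _ {eq_quot (germ_equiv C)})/asboolP.
Qed.

Lemma germ_surj (g : groupoid C) :
  exists (s : Il C) (chi : act_dom s), g = germ chi.
Proof.
exists (projT1 (repr g)), (projT2 (repr g)).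
by rewrite /germ -[LHS]reprK; case: (repr g).
Qed.

Lemma repr_germ (s : Il C) (chi : act_dom s) :
  germ_eq (repr (germ chi)) (existT (fun s : Il C => act_dom s) s chi).
Proof.
apply/asboolP; apply/(@eqquotP _ _ {eq_quot (germ_equiv C)}).
exact: (reprK (germ chi)).
Qed.

Lemma germ_sourceE (s : Il C) (chi : act_dom s) : germ_source (germ chi) = val chi.
Proof. by have [] := repr_germ chi. Qed.

Lemma germ_rangeE (s : Il C) (chi : act_dom s) : germ_range (germ chi) = act chi.
Proof. exact: germ_eq_act (repr_germ chi). Qed.

Lemma groupoid_openP (A : set (groupoid C)) :
  open A <-> forall s : Il C, open [set chi : act_dom s | A (germ chi)].
Proof. exact: (@sigT_openP (Il C) (fun s => act_dom s)). Qed.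

Lemma germ_continuous (s : Il C) : continuous (@germ s).
Proof. by apply/continuousP => A /groupoid_openP. Qed.

Lemma on_Jbar_open (E : set C) : open [set chi : @Jhat C | on_Jbar chi E].
Proof.
rewrite openE => chi [e [n [f [r ce cf]]]].
have nb : nbhs chi [set psi : @Jhat C | val psi e = val chi e /\
    forall i, val psi (f i) = val chi (f i)].
  apply: filterI; first exact: Jhat_eval_nbhs.
  have := @filter_forall _ 'I_n
    (fun i (psi : @Jhat C) => val psi (f i) = val chi (f i)) _ (nbhs_filter chi).
  by apply => i; exact: Jhat_eval_nbhs.
apply: filterS nb => psi [pe pf]; exists e, n, f.
by split=> // [|i]; rewrite ?pe ?pf.
Qed.

Lemma open_bisection (s : Il C) : open (bisection s).
Proof.
apply/groupoid_openP => t; rewrite openE => chi [psi /germP[/= e [E [JE cE ts]]]].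
have cts : continuous (fun x : act_dom t => val (val x) : @Jhat C).
  move=> x; apply: (@continuous_comp (act_dom t) (@dOmega C) (@Jhat C)).
    exact: initial_continuous.
  exact: initial_continuous.
have nE : nbhs chi [set x : act_dom t | on_Jbar (val (val x)) E].
  apply: (cts chi [set y | on_Jbar y E]); apply: open_nbhs_nbhs.
  split; first exact: on_Jbar_open.
  exact: cE.
have ns : nbhs chi [set x : act_dom t | act_dom s (val x)].
  have cs : val (val (val chi)) (Jdom s).
    have {}e : val chi = val psi by [].
    by rewrite e; exact: (set_valP psi).
  have nJ := Jhat_eval_nbhs (val (val chi)) (Jdom s).
  have sub : [set x : act_dom t |
      val (val (val x)) (Jdom s) = val (val (val chi)) (Jdom s)] `<=`
      [set x | act_dom s (val x)] by move=> x /= ex; rewrite /act_dom /= ex.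
  exact: (filterS sub (cts chi _ nJ)).
apply: filterS (filterI nE ns) => x [/= xE xs].
exists (SigSub (mem_set xs)); apply/germP; split=> //.
by exists E.
Qed.

Lemma germ_source_continuous : continuous germ_source.
Proof.
apply/continuousP => A oA; apply/groupoid_openP => s.
have -> : [set chi : act_dom s | (germ_source @^-1` A) (germ chi)] =
          (val : act_dom s -> @dOmega C) @^-1` A.
  by rewrite predeqE => chi /=; rewrite germ_sourceE.
by move: A oA; apply/continuousP; exact: initial_continuous.
Qed.

End GroupoidTopology.

(* Main.v *)
Require Import Defs.
From mathcomp Require Import all_boot.
From mathcomp Require Import all_classical.
From mathcomp Require Import topology_structure separation_axioms.
From mathcomp Require Import initial_topology subtype_topology compact.
From mathcomp Require Import supremum_topology discrete_topology bool_topology.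
From mathcomp Require Import function_spaces.

Set Implicit Arguments.
Unset Strict Implicit.
Unset Printing Implicit Defensive.

Local Open Scope classical_set_scope.

(** For [s] in the inverse hull let [U(s)] be the set of characters
    [chi] in the domain of [s] whose germ [[s, chi]] is a unit, i.e. those with
    [chi(E) = 1] for some [E] in [Jbar] that [s] fixes pointwise.  It is open,
    being the union of the open sets [{chi | chi(E) = 1}] over these [E]; the
    groupoid is etale with a Hausdorff unit space, so it is Hausdorff exactly
    when every [U(s)] is closed in the domain of [s].  The combinatorial
    condition says that finitely many of the open sets already cover [U(s)].

    If the groupoid is Hausdorff, then [U(s)] is closed, as the set where the
    two continuous sections [chi |-> [s, chi]] and [chi |-> [s^-1 s, chi]] agree
    ([fixed_closed]).  The domain of [s] is compact ([act_dom_compact]), so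
    finitely many [E_i] suffice for [U(s)] ([finite_subcover_on_Jbar]).  A
    nonempty [e] in [J] fixed by [s] lies in some maximal character
    ([exists_Jmax]), which belongs to [U(s)], hence has value 1 at some [E_i],
    and then at [e `&` E_i], which is therefore nonempty.

    Conversely, two germs over distinct characters are separated by their
    sources.  Over one character [chi], the germs of [s] and [t] agree exactly
    when [chi(E) = 1] for some [E] fixed by [r = t^-1 s]
    ([germ_eq_quotientP]).  Let [E_i] be the sets that the condition provides
    for [r].  Each set fixed by [r] on which some [psi] in [dOmega] has value 1
    forces [psi(E_i) = 1] for some [i] ([on_Jbar_fixed]).  Otherwise, by
    density, a maximal [psi] would violate this, and for a maximal [psi] the
    values [psi(E) = 1] and [psi(E_i) = 0] are witnessed by members of its
    filter inside [E] and disjoint from [E_i]; their meet is a nonempty element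
    of [J] fixed by [r] and disjoint from all [E_i].  So if the two germs
    at [chi] differ, the condition that all [psi(E_i)] vanish defines a
    neighbourhood of [chi] over which the germs of [s] and [t] never meet. *)

(** * Generalities *)

Lemma initial_cvg (S : choiceType) (T : topologicalType) (f : S -> T)
    (F : set_system (initial_topology f)) (x : initial_topology f) :
  Filter F -> f @ F --> f x -> F --> x.
Proof.
move=> FF Ff A [_ [[B oB <-] /= Bx sBA]].
by apply: filterS sBA _; apply: Ff; exact: open_nbhs_nbhs.
Qed.

Lemma disjoint_absurd (T : Type) (A B : set T) x :
  A `&` B = set0 -> A x -> B x -> False.
Proof. by move=> AB0 Ax Bx; have : (A `&` B) x by []; rewrite AB0. Qed.

(** * Values of characters on the sets in [Jbar] *)

Section Characters.
Context {C : lc_category}.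
Implicit Types (chi psi : @Jhat C) (e f g : J C) (E : set C).

Lemma Jhat_values_nbhs chi e n (f : 'I_n -> J C) :
  nbhs chi [set psi : @Jhat C | val psi e = val chi e /\
    forall i, val psi (f i) = val chi (f i)].
Proof.
apply: filterI; first exact: Jhat_eval_nbhs.
have := @filter_forall _ 'I_n
  (fun i (psi : @Jhat C) => val psi (f i) = val chi (f i)) _ (nbhs_filter chi).
by apply=> i; exact: Jhat_eval_nbhs.
Qed.

(** Inside [Omega] the sets [{psi | psi(E) = 1}] are also closed, because there
    [psi(E)] can be read off from any one fixed representation of [E]. *)
Lemma off_Jbar_nbhs chi n (eps : 'I_n -> set C) : Omega chi ->
  (forall i, Jbar C (eps i)) -> (forall i, ~ on_Jbar chi (eps i)) ->
  nbhs chi [set psi : @Jhat C | forall i, Omega psi -> ~ on_Jbar psi (eps i)].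
Proof.
move=> Ochi Jeps neps.
have := @filter_forall _ 'I_n (fun i (psi : @Jhat C) =>
  Omega psi -> ~ on_Jbar psi (eps i)) _ (nbhs_filter chi); apply=> i.
have [e [m [f rE]]] := Jeps i.
apply: filterS (Jhat_values_nbhs chi e f) => psi [pe pf] Opsi.
move=> /(on_Jbar_rep Opsi rE)[]; rewrite pe => ce cf; apply: (neps i).
by apply/(on_Jbar_rep Ochi rE); split=> // j; rewrite -pf.
Qed.

Lemma on_Jbar_neq0 chi E : Omega chi -> on_Jbar chi E -> E !=set0.
Proof.
move=> Ochi cE; apply/set0P/eqP => E0.
have [e [_ [_ [_ _ _]]]] := cE.
(* [e] minus [e] represents the empty set, and no value of [chi] at [e] can
   satisfy it. *)
have rE : Jbar_rep E e (fun _ : 'I_1 => e).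
  split=> [_ x //|]; rewrite E0; apply/esym; rewrite -subset0 => x [ex]; apply.
  by exists ord0.
by have /(on_Jbar_rep Ochi rE)[-> /(_ ord0)] := cE.
Qed.

Lemma Jhat_finite_disjoint chi n (A : 'I_n -> set C) :
  (forall i, exists2 g, val chi g & val g `&` A i = set0) ->
  exists2 g, val chi g & forall i, val g `&` A i = set0.
Proof.
elim: n A => [|n IH] A gA.
  by have [[g cg] _ _] := set_valP chi; exists g => // -[].
have [g cg g0] := IH (fun i => A (lift ord0 i)) (fun i => gA _).
have [h ch h0] := gA ord0.
exists (Jmeet g h) => [|i]; first by rewrite JhatM cg ch.
rewrite -subset0 => x [[/= gx hx]]; case: (unliftP ord0 i) => [j|] -> Ax.
  exact: disjoint_absurd (g0 j) gx Ax.
exact: disjoint_absurd h0 hx Ax.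
Qed.

(** A maximal character behaves like an ultrafilter: both [chi(E) = 1] and, in
    the next lemma, [chi(E) = 0] are witnessed by a single member of [J]. *)
Lemma Jmax_on_Jbar chi E : Jmax chi -> on_Jbar chi E ->
  exists2 g, val chi g & val g `<=` E.
Proof.
move=> mchi [e [n [f [[_ ->] ce cf]]]].
have [g cg g0] := Jhat_finite_disjoint (A := fun i => val (f i))
  (fun i => Jmax_meet0 mchi (cf i)).
exists (Jmeet e g); first by rewrite JhatM ce cg.
move=> x [/= ex gx]; split=> // -[i _ fx].
exact: disjoint_absurd (g0 i) gx fx.
Qed.

Lemma Jmax_off_Jbar chi E : Jmax chi -> Jbar C E -> ~ on_Jbar chi E ->
  exists2 g, val chi g & val g `&` E = set0.
Proof.
move=> mchi [e [n [f rE]]] nE; have [_ ->] := rE.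
have [ce|/negbTE ce] := boolP (val chi e); last first.
  have [g cg g0] := Jmax_meet0 mchi ce; exists g => //.
  by rewrite -subset0 => x [gx [ex _]]; exact: disjoint_absurd g0 gx ex.
have [i cf] : exists i, val chi (f i).
  apply: contrapT => /forallNP nf; apply: nE.
  by exists e, n, f; split=> // i; apply/negbTE/negP.
exists (f i) => //; rewrite -subset0 => x [fx [_ nf]].
by apply: nf; exists i.
Qed.

(** Zorn's lemma, applied to the filters of [J] containing [e]; the one of all
    [f] containing a given point of [e] shows that there are any. *)
Lemma exists_Jmax e : val e !=set0 -> exists2 chi, Jmax chi & val chi e.
Proof.
move=> [x0 ex0].
pose filt (S : set (J C)) := [/\ S e,
  forall f g, S (Jmeet f g) <-> S f /\ S g & forall f, val f = set0 -> ~ S f].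
(* The empty family is admitted because it is the union of the empty chain. *)
have [F FF|M [PM maxM]] := @Zorn_bigcup _ [set S | S = set0 \/ filt S].
  move=> totF; have [[S FS [Se SM S0]]|nF] := pselect (exists2 S, F S & filt S).
    right; split.
    - by exists S.
    - move=> f g; split=> [[T FT Tfg]|[[T FT Tf] [T' FT' T'g]]].
        case: (FF T FT) => [T0|[_ TM _]]; first by rewrite T0 in Tfg.
        by have [Tf Tg] := (TM f g).1 Tfg; split; exists T.
      case: (FF T FT) => [T0|[_ TM _]]; first by rewrite T0 in Tf.
      case: (FF T' FT') => [T'0|[_ T'M _]]; first by rewrite T'0 in T'g.
      have [sTT|sTT] := totF _ _ FT FT'.
        by exists T' => //; apply/T'M; split=> //; exact: sTT.
      by exists T => //; apply/TM; split=> //; exact: sTT.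
    - move=> f f0 [T FT Tf]; case: (FF T FT) => [T0|[_ _ TN]].
        by rewrite T0 in Tf.
      exact: TN Tf.
  left; rewrite -subset0 => f [T FT Tf]; case: (FF T FT) => [T0|fT].
    by rewrite T0 in Tf.
  by apply: nF; exists T.
have fx0 : filt [set f | val f x0].
  by split=> // f f0 /=; rewrite f0.
have [Me MM M0] : filt M.
  case: PM => // M0; case: (maxM [set f | val f x0]); last by right.
  rewrite M0; split; first exact: sub0set.
  by move=> /(_ e); apply.
pose chi0 : {ptws J C -> bool} := fun f => `[< M f >].
have chiP : Jhat chi0.
  split; first by exists e; apply/asboolP.
  - move=> f g; apply/asboolP/andP => [/MM[Mf Mg]|[/asboolP Mf /asboolP Mg]].
      by split; apply/asboolP.
    by apply/MM.
  - by move=> f f0; apply/asboolP; exact: M0.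
exists (SigSub (mem_set chiP)); last exact/asboolP.
move=> psi le.
have {}le : M `<=` [set f | val psi f] by move=> f Mf; apply: le; exact/asboolP.
have eqM : [set f | val psi f] `<=` M.
  apply: contrapT => nle; apply: (maxM [set f | val psi f]) => //.
  right; split; first exact: le.
    by move=> f g /=; rewrite JhatM; split=> /andP.
  by move=> f /(Jhat0 psi) /= ->.
rewrite predeqE => f; split=> [/asboolP/le//|/eqM Mf]; exact/asboolP.
Qed.

(** [Jhat] is not compact in general, as limits of characters may vanish
    identically; prescribing the value 1 at [Jdom s] excludes this.  The limit of
    an ultrafilter takes at each [e] the value that is taken almost surely. *)
Lemma act_dom_compact (s : Il C) : compact [set: act_dom s].
Proof.
rewrite compact_ultra => F UF _.
pose mem e : set (act_dom s) := [set x : act_dom s | val (val (val x)) e].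
pose lim : {ptws J C -> bool} := fun e => `[< F (mem e) >].
have memF e : F [set x : act_dom s | val (val (val x)) e = lim e].
  have [Fe|Fe] := in_ultra_setVsetC (mem e) UF.
    by apply: filterS (Fe) => x /= xe; rewrite [LHS]xe; apply/esym/asboolP.
  apply: filterS (Fe) => x /= /negP/negbTE xe; rewrite [LHS]xe.
  apply/esym/asboolP => Fe'.
  by have [y []] := filter_ex (filterI Fe' Fe).
have limP : Jhat lim.
  split.
  - exists (Jdom s); apply/asboolP; apply: filterS filterT => x _.
    exact: (set_valP x).
  - move=> e f; have [x [[<- <-] <-]] :=
      filter_ex (filterI (filterI (memF (Jmeet e f)) (memF e)) (memF f)).
    exact: JhatM.
  - move=> e e0; have [x <-] := filter_ex (memF e).
    exact: Jhat0.
pose chi : @Jhat C := SigSub (mem_set limP).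
have Fchi : (fun x : act_dom s => val (val x)) @ F --> chi.
  apply: initial_cvg; apply/cvg_sup => e A [_ [[B oB <-] Be sBA]].
  suff : F [set x : act_dom s | A (val (val (val x)))] by [].
  apply: filterS (memF e) => x /= xe; apply: sBA.
  by rewrite /preimage /= /proj xe.
have dchi : dOmega chi.
  apply: closed_closure => U /Fchi FU.
  have {}FU : F [set x : act_dom s | U (val (val x))] by [].
  have [x Ux] := filter_ex FU.
  by exists (val (val x)); split=> //; exact: set_valP.
have schi : act_dom s (SigSub (mem_set dchi)).
  apply/asboolP; apply: filterS filterT => x _.
  exact: (set_valP x).
exists (SigSub (mem_set schi)); split=> //.
by apply: initial_cvg; apply: initial_cvg; exact: Fchi.
Qed.

End Characters.

(** * Germs and sets of fixed points *)

Section Germs.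
Context {C : lc_category}.
Implicit Types (s t : Il C) (E : set C).

Lemma prestr_pidP (r : set (C * C)) E : partial_bijection r ->
  prestr r E = pid E <-> forall x, E x -> r (x, x).
Proof.
move=> [rf _]; split=> [rE x Ex|rE].
  by have : pid E (x, x) by []; rewrite -rE => -[].
rewrite predeqE => -[x y]; split=> /= [[rxy Ex]|[Ex /= ->]].
  by split=> //=; exact: rf rxy (rE x Ex).
by split=> //; exact: rE.
Qed.

(** The germs of [s] and [t] agree iff [t^-1 s] has the germ of a unit: where
    [s] and [t] take the same value, [t^-1 s] fixes the point, and conversely. *)
Lemma germ_eq_quotientP s t (chi : act_dom s) (psi : act_dom t) :
  val chi = val psi ->
  germ chi = germ psi <->
  exists2 E, on_Jbar (val (val chi)) E &
    forall x, E x -> Defs.pcomp (Defs.pinv (val t)) (val s) (x, x).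
Proof.
move=> chipsi; have [sf _] := Il_pbij (set_valP s).
have [tf _] := Il_pbij (set_valP t); split.
  move=> /germP[_ /= [E [_ cE st]]].
  have cs : on_Jbar (val (val chi)) (val (Jdom s)).
    by apply: on_JbarT; exact: (set_valP chi).
  (* Outside both domains [s] and [t] agree too, but [t^-1 s] fixes nothing. *)
  exists (E `&` val (Jdom s)); first exact: on_JbarI.
  move=> x [Ex [y sxy]]; exists y; split=> //=.
  have : prestr (val s) E (x, y) by [].
  by rewrite st => -[].
move=> [E cE rE]; apply/germP; split=> //=; exists E; split=> //.
  exact: on_Jbar_sub cE.
rewrite predeqE => -[x z]; split=> /= -[h Ex]; split=> //;
  have [y [/= sxy txy]] := rE x Ex.
  by rewrite (sf _ _ _ h sxy).
by rewrite (tf _ _ _ h txy).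
Qed.

Lemma act_dom_values_continuous s :
  continuous (fun x : act_dom s => val (val x) : @Jhat C).
Proof.
move=> x; apply: (@continuous_comp (act_dom s) (@dOmega C) (@Jhat C)).
  exact: initial_continuous.
exact: initial_continuous.
Qed.

Lemma dOmega_separated (chi psi : @dOmega C) : chi <> psi ->
  exists A B : set (@dOmega C),
    [/\ open A, open B, A chi, B psi & A `&` B = set0].
Proof.
move=> ne; have [e ne_e] : exists e, val (val chi) e <> val (val psi) e.
  apply: contrapT => /forallNP h; apply: ne; apply: val_inj; apply: val_inj.
  by apply: funext => e; apply: contrapT; exact: h.
have op b : open [set x : @dOmega C | val (val x) e = b].
  have ce : continuous (fun x : @dOmega C => val (val x) e).
    move=> x; apply: (@continuous_comp (@dOmega C) (@Jhat C) bool val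
      (fun y => val y e)); first exact: initial_continuous.
    exact: Jhat_eval_continuous.
  have /continuousP/(_ [set b]) := ce; apply.
  exact: discrete_open.
exists [set x | val (val x) e = val (val chi) e],
  [set x | val (val x) e = val (val psi) e]; split=> //.
by rewrite -subset0 => x [/= -> /ne_e].
Qed.

(** Without a finite subcover, the parts of the covered set that finitely many
    of the [E] leave uncovered would form a proper filter base, hence have a
    cluster point; it would lie in the closed covered set, so in one of the [E],
    whose complement is in the filter. *)
Lemma finite_subcover_on_Jbar s (good : set (set C)) :
  (forall E, good E -> Jbar C E) ->
  closed [set chi : act_dom s | exists2 E, good E & on_Jbar (val (val chi)) E] ->
  exists2 l : seq (set C), (forall E, E \in l -> good E) &
    forall (chi : act_dom s) E, good E -> on_Jbar (val (val chi)) E ->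
      exists2 E', E' \in l & on_Jbar (val (val chi)) E'.
Proof.
move=> goodJ; set U := [set chi | _] => cU; apply: contrapT => nfin.
pose rest (l : seq (set C)) : set (act_dom s) :=
  [set chi | U chi /\ forall E, E \in l -> ~ on_Jbar (val (val chi)) E].
pose D : set (seq (set C)) := [set l | forall E, E \in l -> good E].
have FF : ProperFilter (filter_from D rest).
  apply: filter_from_proper; first apply: filter_from_filter.
  - by exists [::].
  - move=> l l' Dl Dl'; exists (l ++ l') => [E|].
      by rewrite mem_cat => /orP[/Dl|/Dl'].
    move=> x [Ux nx]; split; split=> // E El; apply: nx.
      by rewrite mem_cat El.
    by rewrite mem_cat El orbT.
  - move=> l Dl; apply: contrapT => emp; apply: nfin; exists l => //.
    move=> chi E gE cE; apply: contrapT => nl; apply: emp; exists chi.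
    by split=> [|E' lE' cE']; [exists E|apply: nl; exists E'].
have [chi [_ clchi]] := @act_dom_compact _ s _ FF filterT.
have [E gE cE] : U chi.
  apply: cU => A nA; have [|x [[Ux _] Ax]] := clchi (rest [::]) A _ nA.
    by exists [::].
  by exists x.
have nE : nbhs chi [set x : act_dom s | on_Jbar (val (val x)) E].
  have /(_ [set y | on_Jbar y E]) := @act_dom_values_continuous s chi; apply.
  by apply: open_nbhs_nbhs; split; [exact: on_Jbar_open|].
have [|x [[_ nx] xE]] := clchi (rest [:: E]) _ _ nE.
  by exists [:: E] => // E'; rewrite inE => /eqP ->.
by apply: (nx E) => //; rewrite inE.
Qed.

End Germs.

(** * The Hausdorff property *)

Section Criterion.
Context {C : lc_category}.

(** By density of the maximal characters a counterexample [chi] can be replaced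
    by a maximal one, whose filter then contains a set fixed by [r] and disjoint
    from all [eps i]. *)
Lemma on_Jbar_fixed (r : set (C * C)) n (eps : 'I_n -> set C) E
    (chi : @Jhat C) :
  (forall i, Jbar C (eps i)) ->
  (forall e : J C, val e !=set0 -> (forall x, val e x -> r (x, x)) ->
    exists i, val e `&` eps i !=set0) ->
  dOmega chi -> (forall x, E x -> r (x, x)) -> on_Jbar chi E ->
  exists i, on_Jbar chi (eps i).
Proof.
move=> Jeps meets dchi rE cE; apply: contrapT => /forallNP neps.
have nE : nbhs chi [set psi : @Jhat C | on_Jbar psi E].
  by apply: open_nbhs_nbhs; split; [exact: on_Jbar_open|].
have neps' := off_Jbar_nbhs (dOmega_Omega dchi) Jeps neps.
have [psi [mpsi [pE peps]]] := dchi _ (filterI nE neps').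
have [g pg gE] := Jmax_on_Jbar mpsi pE.
have [h ph h0] := Jhat_finite_disjoint (fun i =>
  Jmax_off_Jbar mpsi (Jeps i) (peps i (Jmax_Omega mpsi))).
have gh0 : val (Jmeet g h) !=set0.
  apply/set0P/eqP => /(Jhat0 psi).
  by rewrite JhatM pg ph.
have [|i [x [[_ hx] ex]]] := meets (Jmeet g h) gh0.
  by move=> x [/gE/rE].
exact: disjoint_absurd (h0 i) hx ex.
Qed.

Lemma germ_eq_closed (s t : Il C) (j : act_dom s -> act_dom t) :
  hausdorff_space (groupoid C) -> (forall chi, val (j chi) = val chi) ->
  closed [set chi : act_dom s | germ chi = germ (j chi)].
Proof.
rewrite open_hausdorff => hd jE.
have cj : continuous j.
  apply: continuous_comp_initial.
  rewrite (_ : _ \o _ = (val : act_dom s -> @dOmega C)); last exact: funext.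
  exact: initial_continuous.
rewrite -[X in closed X]setCK; apply: open_closedC; rewrite openE => chi /eqP.
move=> /hd[[A B] /= [/set_mem Achi /set_mem Bchi] [oA oB /eqP AB0]].
have nA : nbhs chi [set x : act_dom s | A (germ x)].
  by apply: germ_continuous; exact: open_nbhs_nbhs.
have nB : nbhs chi [set x : act_dom s | B (germ (j x))].
  apply: (cj chi [set y | B (germ y)]).
  by apply: germ_continuous; exact: open_nbhs_nbhs.
apply: filterS (filterI nA nB) => x [/= Ax Bx] AeB.
by apply: (disjoint_absurd AB0 (x := germ x)) => //; rewrite AeB.
Qed.

(** The set in question is where the germs of [s] and of the idempotent [s^-1 s]
    agree. *)
Lemma fixed_closed (s : Il C) : hausdorff_space (groupoid C) ->
  closed [set chi : act_dom s | exists2 E,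
    Jbar C E /\ (forall x, E x -> val s (x, x)) & on_Jbar (val (val chi)) E].
Proof.
move=> hd; have [sf si] := Il_pbij (set_valP s).
pose u : Il C :=
  SigSub (mem_set (Il_comp (Il_inv (set_valP s)) (set_valP s))).
have us : Jdom u = Jdom s.
  apply: Jval_inj; rewrite predeqE => x.
  by split=> [[z [y [sxy _]]]|[y sxy]]; [exists y|exists x; exists y].
have udom (chi : act_dom s) : act_dom u (val chi).
  by rewrite /act_dom /= us; exact: (set_valP chi).
have := @germ_eq_closed s u (fun chi => SigSub (mem_set (udom chi))) hd.
move=> /(_ (fun=> erefl)); congr closed; rewrite predeqE => chi /=.
rewrite germ_eq_quotientP//; split=> [[E cE rE]|[E [_ sE] cE]]; exists E => //.
  split=> [|x Ex]; first exact: on_Jbar_sub cE.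
  have [y [/= sxy [z [/= sxz syz]]]] := rE x Ex.
  by have /= yx := si _ _ _ syz sxz; rewrite yx in sxy.
move=> x Ex; exists x; split; first exact: sE.
by exists x; split; exact: sE.
Qed.

(** Any element of [J] fixed by [s] is inside a maximal character, so it meets
    the members of a finite subcover of the characters with unit germ. *)
Lemma hausdorff_finite_fixed (s : Il C) : hausdorff_space (groupoid C) ->
  exists (n : nat) (eps : 'I_n -> set C),
    (forall i, Jbar C (eps i) /\ forall x, eps i x -> val s (x, x)) /\
    forall e : J C, val e !=set0 -> (forall x, val e x -> val s (x, x)) ->
      exists i, val e `&` eps i !=set0.
Proof.
move=> hd.
have [|l lgood lcov] := finite_subcover_on_Jbar _ (fixed_closed (s := s) hd).
  by move=> E [].
exists (size l), (tnth (in_tuple l)); split=> [i|e ne fe].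
  exact: lgood _ (mem_tnth i (in_tuple l)).
have [chi mchi ce] := exists_Jmax ne.
have dchi : dOmega chi by exact: subset_closure.
have schi : act_dom s (SigSub (mem_set dchi)).
  by apply: Jhat_le ce => x /fe sx; exists x.
have cE : on_Jbar chi (val e) by exact: on_JbarT.
have [|E' /(tnthP (in_tuple l))[i ->] cE'] :=
  lcov (SigSub (mem_set schi)) (val e) _ cE.
  by split=> //; exact: on_Jbar_sub cE.
exists i; apply: (@on_Jbar_neq0 _ chi); first exact: Jmax_Omega.
exact: on_JbarI.
Qed.

(** On the neighbourhood [W] of the common source where all [eps i] have value
    0, the germs of [s] and [t] are different everywhere, so that the parts of
    the two bisections over [W] are disjoint. *)
Lemma germs_separated (s t : Il C) (chi : act_dom s) (psi : act_dom t)
    n (eps : 'I_n -> set C) (r := Defs.pcomp (Defs.pinv (val t)) (val s)) :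
  (forall i, Jbar C (eps i)) -> (forall i x, eps i x -> r (x, x)) ->
  (forall e : J C, val e !=set0 -> (forall x, val e x -> r (x, x)) ->
    exists i, val e `&` eps i !=set0) ->
  val chi = val psi -> germ chi <> germ psi ->
  exists A B : set (groupoid C),
    [/\ open A, open B, A (germ chi), B (germ psi) & A `&` B = set0].
Proof.
move=> Jeps reps meets chipsi gh.
pose W := [set x : @dOmega C | forall i, ~ on_Jbar (val x) (eps i)].
have oW : open W.
  rewrite openE => x Wx.
  have nW : nbhs (val x : @Jhat C)
      [set y : @Jhat C | forall i, Omega y -> ~ on_Jbar y (eps i)].
    by apply: off_Jbar_nbhs => //; exact/dOmega_Omega/(set_valP x).
  have {}nW : nbhs x [set y : @dOmega C | forall i,
      Omega (val y) -> ~ on_Jbar (val y) (eps i)].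
    exact: (@initial_continuous _ (@Jhat C) val x _ nW).
  apply: filterS nW => y Wy i.
  exact/Wy/dOmega_Omega/(set_valP y).
have osW : open (germ_source @^-1` W).
  by move: W oW; apply/continuousP; exact: germ_source_continuous.
have Wchi : W (val chi).
  move=> i ci; apply: gh; apply/germ_eq_quotientP => //.
  by exists (eps i) => //; exact: reps.
exists (bisection s `&` germ_source @^-1` W),
  (bisection t `&` germ_source @^-1` W); split.
- by apply: openI => //; exact: open_bisection.
- by apply: openI => //; exact: open_bisection.
- by split; [exists chi|rewrite /preimage /= germ_sourceE].
- by split; [exists psi|rewrite /preimage /= germ_sourceE -chipsi].
rewrite -subset0 => k [[[x kx] Wk] [[y ky] _]].
have xy : val x = val y by rewrite -!germ_sourceE -kx -ky.
have : germ x = germ y by rewrite -kx -ky.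
move=> /(germ_eq_quotientP xy)[E cE rE].
have [i ci] := on_Jbar_fixed Jeps meets (set_valP (val x)) rE cE.
by move: Wk; rewrite /= kx /preimage /= germ_sourceE => /(_ i).
Qed.

End Criterion.

Theorem lemma5p2 (C : lc_category) :
  hausdorff_space (groupoid C) <->
  forall s : set (C * C), Il C s ->
    exists (n : nat) (eps : 'I_n -> set C),
      (forall i, Jbar C (eps i) /\ prestr s (eps i) = pid (eps i)) /\
      forall e : set C, J C e -> e !=set0 -> prestr s e = pid e ->
        exists i, e `&` eps i !=set0.
Proof.
split=> [hd s Is|cond].
  have pb := Il_pbij Is.
  have [n [eps [good meets]]] := hausdorff_finite_fixed (SigSub (mem_set Is)) hd.
  exists n, eps; split=> [i|e Je ne /(prestr_pidP _ pb) fe].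
    by have [? ?] := good i; split=> //; apply/prestr_pidP.
  exact: meets (SigSub (mem_set Je)) ne fe.
rewrite open_hausdorff => g h /eqP.
have [s [chi ->]] := germ_surj g; have [t [psi ->]] := germ_surj h => gh.
suff [A [B [oA oB Ag Bh AB0]]] : exists A B : set (groupoid C),
    [/\ open A, open B, A (germ chi), B (germ psi) & A `&` B = set0].
  by exists (A, B); [split; exact: mem_set|split=> //; exact/eqP].
have [chipsi|ne] := pselect (val chi = val psi); last first.
  have [A [B [oA oB Achi Bpsi AB0]]] := dOmega_separated ne.
  exists (germ_source @^-1` A), (germ_source @^-1` B).
  split; rewrite /preimage /= ?germ_sourceE //.
  - by move: A oA {Achi AB0}; apply/continuousP; exact: germ_source_continuous.
  - by move: B oB {Bpsi AB0}; apply/continuousP; exact: germ_source_continuous.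
  - by rewrite -[LHS]/(germ_source @^-1` (A `&` B)) AB0 preimage_set0.
pose r := Defs.pcomp (Defs.pinv (val t)) (val s).
have Ir : Il C r by apply: Il_comp; [apply: Il_inv|]; exact: set_valP.
have pr := Il_pbij Ir; have [n [eps [good meets]]] := cond r Ir.
apply: (@germs_separated _ s t chi psi n eps _ _ _ chipsi gh) => [i|i|e ne re].
- by have [] := good i.
- by have [_ /(prestr_pidP _ pr)] := good i.
- by apply: meets => //; [exact: set_valP|apply/prestr_pidP].
Qed.
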